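(* Let $\Bbbk$ be an algebraically closed field of characteristic zero and let $n,m\ge 1$ be integers with $mn\ge 2$. Let $G\subseteq\mathrm{SAut}(\mathrm{Mat}(n,m))$ be the subgroup generated by all elementary one-parameter unipotent subgroups. Given two finite ordered collections $\mathcal{B}$ and $\mathcal{B}'$ of distinct matrices in $\mathrm{Mat}(n,m)$ of the same cardinality, with the same sequence of ranks, and in the case $m=n$ with the same sequence of determinants, one can simultaneously transform $\mathcal{B}$ into $\mathcal{B}'$ by means of an element $g\in G$ (that is, if $\mathcal{B}=(B_1,\dots,B_k)$ and $\mathcal{B}'=(B_1',\dots,B_k')$, there is $g\in G$ with $g.B_i=B_i'$ for all $i$).
   Context: $X=\mathrm{Mat}(n,m)$ is the affine space of all $n\times m$ matrices over $\Bbbk$. $\mathrm{SAut}(X)$ is the subgroup of $\mathrm{Aut}(X)$ generated by all algebraic subgroups isomorphic to $\mathbb{G}_a$. For $k\ne l$ let $E_{kl}\in\mathfrak{sl}_n$ and $E^{kl}\in\mathfrak{sl}_m$ be the matrices with $(k,l)$-entry $1$ and all other entries $0$, and let $H_{kl}=I_n+\Bbbk E_{kl}\subseteq\mathrm{SL}_n$ and $H^{kl}=I_m+\Bbbk E^{kl}\subseteq\mathrm{SL}_m$ be the corresponding one-parameter unipotent subgroups, acting on $X$ via left, respectively right, multiplication (through the left-right multiplication action of $\mathrm{SL}_n\times\mathrm{SL}_m$ on $X$). A replica of a one-parameter unipotent subgroup $H=\exp(\Bbbk\partial)$ of $\mathrm{Aut}(X)$, where $\partial$ is a locally nilpotent derivation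 of $\mathcal{O}(X)$, is a subgroup of the form $H_f=\exp(\Bbbk f\partial)$ with $f\in\ker\partial=\mathcal{O}(X)^H$. The elementary one-parameter unipotent subgroups are the subgroups $H_{kl}$, $H^{kl}$ ($k\neq l$) and all their replicas. *)

(* Defs.v *)
From HB Require Import structures.
From mathcomp Require Import all_boot all_order all_algebra.
From mathcomp.multinomials Require Export mpoly.

Set Implicit Arguments.
Unset Strict Implicit.
Unset Printing Implicit Defensive.

Import GRing.Theory.
Local Open Scope ring_scope.

Section AffineSpaceOfMatrices.
Variables (K : fieldType) (n m : nat).

Local Notation X := 'M[K]_(n, m).
(* The coordinate ring O(X); the variable of index mxvec_index i j is the
   (i, j)-entry. *)
Local Notation O := {mpoly K[n * m]}.

Definition mxeval (p : O) (A : X) : K := p.@[fun i => mxvec A 0 i].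

(* A map is a morphism of varieties iff it pulls regular functions back to
   regular functions. *)
Definition regular (phi : X -> X) : Prop :=
  forall p : O, exists q : O, forall A, mxeval p (phi A) = mxeval q A.

(* The group Aut(X).  Elements are only ever compared through their underlying
   maps, so no quotient is needed. *)
Record autX : Type := AutX {
  aut_fun :> X -> X;
  aut_inv : X -> X;
  aut_funK : cancel aut_fun aut_inv;
  aut_invK : cancel aut_inv aut_fun;
  aut_fun_regular : regular aut_fun;
  aut_inv_regular : regular aut_inv
}.

Lemma regular_id : regular id.
Proof. by move=> p; exists p. Qed.

Lemma regular_comp phi psi :
  regular phi -> regular psi -> regular (phi \o psi).
Proof.
move=> hphi hpsi p; have [q hq] := hphi p; have [r hr] := hpsi q.
by exists r => A; rewrite /= hq hr.
Qed.

Definition aut_one : autX :=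
  @AutX id id (fun=> erefl) (fun=> erefl) regular_id regular_id.

Definition aut_mul (g h : autX) : autX :=
  AutX (can_comp (aut_funK g) (aut_funK h))
       (can_comp (aut_invK h) (aut_invK g))
       (regular_comp (aut_fun_regular g) (aut_fun_regular h))
       (regular_comp (aut_inv_regular h) (aut_inv_regular g)).

Definition aut_opp (g : autX) : autX :=
  AutX (aut_invK g) (aut_funK g) (aut_inv_regular g) (aut_fun_regular g).

Inductive generated (S : autX -> Prop) : autX -> Prop :=
| generated_in g : S g -> generated S g
| generated_one : generated S aut_one
| generated_mul g h : generated S g -> generated S h -> generated S (aut_mul g h)
| generated_inv g : generated S g -> generated S (aut_opp g).

Definition derivation (D : O -> O) : Prop :=
  linear D /\ forall p q, D (p * q) = D p * q + p * D q.

Definition locally_nilpotent (D : O -> O) : Prop :=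
  forall p, exists r, iter r D p = 0.

(* exp_at D p q states that exp(D)(p) = q; the choice of r is irrelevant, since
   a linear D satisfies iter i D p = 0 for all i >= r. *)
Definition exp_at (D : O -> O) (p q : O) : Prop :=
  exists r, iter r D p = 0 /\
    q = \sum_(i < r) (i`!%:R)^-1 *: iter i D p.

(* The subgroup exp(K D): those automorphisms whose comorphism is exp(s D) for
   some s in K.  (The other convention, in which g acts on O(X) by pulling back
   along g^-1, replaces s by -s and defines the same subgroup.) *)
Definition exp_subgroup (D : O -> O) (g : autX) : Prop :=
  exists s : K, forall p, exists q,
    exp_at (fun u => s *: D u) p q /\ forall A, mxeval p (g A) = mxeval q A.

Definition replica (H H' : autX -> Prop) : Prop :=
  exists (D : O -> O) (f : O),
    [/\ derivation D, locally_nilpotent D,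
        (forall g, H g <-> exp_subgroup D g),
        D f = 0
      & forall g, H' g <-> exp_subgroup (fun p => f * D p) g].

Definition left_root_subgroup (k l : 'I_n) (g : autX) : Prop :=
  exists t : K, forall A, g A = (1%:M + t *: delta_mx k l) *m A.

Definition right_root_subgroup (k l : 'I_m) (g : autX) : Prop :=
  exists t : K, forall A, g A = A *m (1%:M + t *: delta_mx k l).

Definition root_subgroup (H : autX -> Prop) : Prop :=
  (exists k l, k != l /\ H = left_root_subgroup k l) \/
  (exists k l, k != l /\ H = right_root_subgroup k l).

Definition elementary_subgroup (H : autX -> Prop) : Prop :=
  root_subgroup H \/ exists2 H0, root_subgroup H0 & replica H0 H.

Definition elementary_group : autX -> Prop :=
  generated (fun g => exists2 H, elementary_subgroup H & H g).

End AffineSpaceOfMatrices.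

Arguments elementary_group {K n m} g.

(* Main.v *)
Require Import Defs.
From HB Require Import structures.
From mathcomp Require Import all_boot all_order all_algebra.

Set Implicit Arguments.
Unset Strict Implicit.
Unset Printing Implicit Defensive.

Import GRing.Theory.
Local Open Scope ring_scope.

(** Write [A_00] for the corner entry of a matrix [A].  The proof rests on the
remark that a finite family of matrices with pairwise distinct corner entries
can be moved componentwise: for [k <> 0] and any polynomial [P] in one
variable, [A |-> A + P(A_00) E_kl A] belongs to a replica of the root subgroup
[H_kl], because [A_00] is invariant under [H_kl]; by interpolation [P] takes
arbitrary prescribed values at the corner entries of the family.  The same
holds for columns.  So each member of the family undergoes, independently of
the others, any sequence of operations that add a multiple of some row, or
column, to one of index [k <> 0] ([reach_line_eq]).

If [A_00] is nonzero, such operations clear the rest of the first row and of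
the first column, and what remains in the complementary block is the action of
all transvections, whose orbits are classified by rank and determinant
([line_eq_same_corner], [same_rank_det_line_eq]).  Hence two families with the
same distinct corner entries, nonzero except at the zero matrix, and with the
same ranks and determinants are in the same orbit.

It remains to produce such corner entries.
- Row and column operations with constant coefficients replace [A_00] by the
  sum of the [t ^ (l + n j) A_lj], [n] being the number of rows.  For all but
  finitely many [t] this separates the matrices of the family and vanishes
  only on the zero matrix ([reach_distinct_corners]).
- Then a neighbouring entry [A_01] (or [A_10]) of each nonzero matrix can be
  given any prescribed value by adding a multiple of the first column to the
  second.  If these values are distinct and nonzero, coefficients depending on
  that entry may in turn be used to modify the corner, which thus gets any
  prescribed value ([reach_corner]).  This is where [m * n >= 2] is used.

That the maps above are in replicas in the sense of exponentials of locally
nilpotent derivations is seen on the flow of a linear vector field [D] of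
square zero: it is a homomorphism [Phi : O -> O[t]] with
[d/dt (Phi p) = Phi (D p)] ([deriv_flow]), so that [D ^ k p] is [k!] times the
coefficient of [t ^ k] in [Phi p].  As [Phi p] is a polynomial in [t], this
yields both local nilpotency and the exponential formula
([iter_vector_field], [exp_at_replica]). *)

(** * Flows of square-zero linear vector fields *)

Lemma mpoly_subalgebra_ind (K : fieldType) (d : nat)
    (P : {mpoly K[d]} -> Prop) :
  (forall c, P c%:MP) -> (forall i, P 'X_i) ->
  (forall p q, P p -> P q -> P (p + q)) ->
  (forall p q, P p -> P q -> P (p * q)) -> forall p, P p.
Proof.
move=> PC PX PD PM; elim/mpolyind=> [|c mn p _ _ Pp]; first by rewrite -mpolyC0.
apply: PD => //; rewrite -mul_mpolyC; apply: (PM) => //.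
rewrite mpolyXE_id; apply: (big_ind P) => [|p1 p2|i _]; first by rewrite -mpolyC1.
  exact: PM.
elim: (mn i) => [|k IHk]; first by rewrite expr0 -mpolyC1.
by rewrite exprS; apply: PM.
Qed.

(** The components of the linear vector field [v |-> v *m M]. *)
Definition field_coord (K : fieldType) d (M : 'M[K]_d) i : {mpoly K[d]} :=
  \sum_j M j i *: 'X_j.

HB.lock Definition vector_field (K : fieldType) d (M : 'M[K]_d)
    (p : {mpoly K[d]}) : {mpoly K[d]} :=
  \sum_i field_coord M i * p^`M(i).

(** The comorphism of [(t, v) |-> v + t *: (v *m M)], with values in [O[t]]. *)
HB.lock Definition flow (K : fieldType) d (M : 'M[K]_d) (p : {mpoly K[d]}) :
    {poly {mpoly K[d]}} :=
  mmap (polyC \o mpolyC d (R := K))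
    (fun i => ('X_i)%:P + field_coord M i *: 'X) p.

Section Flow.
Variables (K : fieldType) (d : nat) (M : 'M[K]_d).
Local Notation O := {mpoly K[d]}.
Local Notation field_coord := (field_coord M).
Local Notation vector_field := (vector_field M).
Local Notation flow := (flow M).

Lemma vector_field_is_linear : linear vector_field.
Proof.
move=> c p q; rewrite vector_field.unlock scaler_sumr -big_split /=.
by apply: eq_bigr => i _; rewrite mderivD mderivZ mulrDr scalerAr.
Qed.

Lemma vector_fieldD p q : vector_field (p + q) = vector_field p + vector_field q.
Proof. by have := vector_field_is_linear 1 p q; rewrite !scale1r. Qed.

Lemma vector_field0 : vector_field 0 = 0.
Proof. by rewrite vector_field.unlock big1 // => i _; rewrite mderiv0 mulr0. Qed.

Lemma vector_fieldZ c p : vector_field (c *: p) = c *: vector_field p.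
Proof.
by have := vector_field_is_linear c p 0; rewrite vector_field0 !addr0.
Qed.

Lemma vector_fieldM p q :
  vector_field (p * q) = vector_field p * q + p * vector_field q.
Proof.
rewrite vector_field.unlock mulr_suml mulr_sumr -big_split /=; apply: eq_bigr => i _.
by rewrite mderivM mulrDr !mulrA (mulrC p).
Qed.

Lemma vector_fieldC c : vector_field c%:MP = 0.
Proof. by rewrite vector_field.unlock big1 // => i _; rewrite mderivC mulr0. Qed.

Lemma vector_fieldX i : vector_field 'X_i = field_coord i.
Proof.
rewrite vector_field.unlock (bigD1 i) //= mderivX mnmE eqxx scale1r.
have -> : (U_(i) - U_(i) = 0 :> 'X_{1..d})%MM.
  by apply/mnmP => j; rewrite mnmBE subnn mnm0E.
rewrite mpolyX0 mulr1 big1 ?addr0 // => j ji.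
by rewrite mderivX mnmE eq_sym (negPf ji) scale0r mulr0.
Qed.

Lemma flowC c : flow c%:MP = (c%:MP)%:P.
Proof. by rewrite flow.unlock mmapC. Qed.

Lemma flowX i : flow 'X_i = ('X_i)%:P + field_coord i *: 'X.
Proof. by rewrite flow.unlock mmapX mmap1U. Qed.

Lemma flowD p q : flow (p + q) = flow p + flow q.
Proof. by rewrite flow.unlock raddfD. Qed.

Lemma flow0 : flow 0 = 0.
Proof. by rewrite flow.unlock raddf0. Qed.

Lemma flowM p q : flow (p * q) = flow p * flow q.
Proof. by rewrite flow.unlock rmorphM. Qed.

Lemma flowZ c p : flow (c *: p) = c%:MP *: flow p.
Proof. by rewrite -mul_mpolyC flowM flowC mul_polyC. Qed.

Lemma flow_at0 p : (flow p).[0] = p.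
Proof.
elim/mpoly_subalgebra_ind: p => [c|i|p q IHp IHq|p q IHp IHq].
- by rewrite flowC hornerC.
- by rewrite flowX !hornerE ?mulr0 ?addr0.
- by rewrite flowD hornerD; congr (_ + _).
- by rewrite flowM hornerM; congr (_ * _).
Qed.

Lemma field_coord_eval i (v : 'rV[K]_d) :
  (field_coord i).@[fun j => v 0 j] = (v *m M) 0 i.
Proof.
rewrite /field_coord raddf_sum mxE /=; apply: eq_bigr => j _.
by rewrite mevalZ mevalXU mulrC.
Qed.

Lemma flow_eval p u (v : 'rV[K]_d) :
  ((flow p).[u]).@[fun j => v 0 j] =
  p.@[fun j => (v + u.@[fun j => v 0 j] *: (v *m M)) 0 j].
Proof.
elim/mpoly_subalgebra_ind: p => [c|i|p q IHp IHq|p q IHp IHq].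
- by rewrite flowC hornerC !mevalC.
- by rewrite flowX !hornerE mevalD mevalM !mevalXU field_coord_eval !mxE mulrC.
- by rewrite flowD hornerD !mevalD; congr (_ + _).
- by rewrite flowM hornerM !mevalM; congr (_ * _).
Qed.

Hypothesis MM0 : M *m M = 0.

(** The components of the field are constant along its trajectories: this is
where [M ^ 2 = 0] enters. *)
Lemma flow_field_coord i : flow (field_coord i) = (field_coord i)%:P.
Proof.
have field0 : \sum_j M j i *: field_coord j = 0.
  transitivity (\sum_j \sum_l (M l j * M j i) *: 'X_l : O).
    apply: eq_bigr => j _; rewrite /field_coord scaler_sumr.
    by apply: eq_bigr => l _; rewrite scalerA mulrC.
  rewrite exchange_big big1 // => l _; rewrite -scaler_suml.
  by have /matrixP/(_ l i) := MM0; rewrite !mxE => ->; rewrite scale0r.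
transitivity (\sum_j (M j i)%:MP *: flow 'X_j).
  rewrite /field_coord (big_morph flow flowD flow0).
  by apply: eq_bigr => j _; rewrite flowZ.
transitivity (\sum_j ((M j i *: 'X_j)%:P + (M j i *: field_coord j)%:P * 'X)).
  apply: eq_bigr => j _; rewrite flowX scalerDr -!mul_polyC !mulrA -!polyCM.
  by rewrite !mul_mpolyC.
by rewrite big_split /= -mulr_suml -!raddf_sum /= field0 mul0r addr0.
Qed.

(** Both sides are derivations along the homomorphism [flow], so it is enough
to compare them on the coordinates. *)
Lemma deriv_flow p : (flow p)^`() = flow (vector_field p).
Proof.
elim/mpoly_subalgebra_ind: p => [c|i|p q IHp IHq|p q IHp IHq].
- by rewrite flowC derivC vector_fieldC flow0.
- rewrite flowX vector_fieldX derivD derivC derivZ derivX add0r flow_field_coord.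
  by rewrite alg_polyC.
- rewrite flowD derivD (vector_fieldD p q) flowD.
  by congr (_ + _); [exact: IHp | exact: IHq].
- rewrite flowM derivM (vector_fieldM p q) flowD !flowM.
  by congr (_ * _ + _ * _); [exact: IHp | exact: IHq].
Qed.

Lemma derivn_flow k p : (flow p)^`(k) = flow (iter k vector_field p).
Proof.
by elim: k => [|k IHk]; rewrite ?derivn0 // derivnS IHk deriv_flow -iterS.
Qed.

(** Taylor's formula in the time variable. *)
Lemma iter_vector_field k p : iter k vector_field p = (flow p)`_k *+ k`!.
Proof.
rewrite -[LHS]flow_at0 -derivn_flow horner_coef0 coef_derivn addn0 ffactnn.
by [].
Qed.

Lemma vector_field_nilpotent p : exists r, iter r vector_field p = 0.
Proof.
by exists (size (flow p)); rewrite iter_vector_field nth_default ?mul0rn.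
Qed.

Lemma vector_field_exp f k p : vector_field f = 0 ->
  vector_field (f ^+ k * p) = f ^+ k * vector_field p.
Proof.
move=> f0; elim: k => [|k IHk]; first by rewrite !mul1r.
by rewrite exprS -mulrA vector_fieldM f0 mul0r add0r IHk mulrA.
Qed.

Lemma iter_replica f s k p : vector_field f = 0 ->
  iter k (fun u => s *: (f * vector_field u)) p =
  (s *: f) ^+ k * iter k vector_field p.
Proof.
move=> f0; elim: k => [|k IHk]; first by rewrite mul1r.
rewrite !iterS IHk vector_field_exp; last by rewrite vector_fieldZ f0 scaler0.
by rewrite scalerAl mulrA -exprS.
Qed.

(** The Taylor expansion of the flow, taken at the time [s *: f]: since [f] is
constant along the flow, it commutes with the vector field. *)
Lemma exp_at_replica (charK : [pchar K] =i pred0) f s p : vector_field f = 0 ->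
  exists r, iter r (fun u => s *: (f * vector_field u)) p = 0 /\
    (flow p).[s *: f] =
    \sum_(i < r) (i`!%:R)^-1 *: iter i (fun u => s *: (f * vector_field u)) p.
Proof.
move=> f0; exists (size (flow p)); split.
  by rewrite iter_replica // iter_vector_field nth_default // mul0rn mulr0.
rewrite horner_coef; apply: eq_bigr => i _.
rewrite iter_replica // iter_vector_field mulrnAr -scaler_nat scalerA mulVf.
  by rewrite scale1r mulrC.
by move/pcharf0P: charK => ->; rewrite -lt0n fact_gt0.
Qed.

End Flow.

(** * Replicas of the root subgroups *)

Section ExpSubgroup.
Variables (K : closedFieldType) (charK : [pchar K] =i pred0) (n m : nat).
Local Notation X := 'M[K]_(n, m).
Local Notation O := {mpoly K[n * m]}.

(** The sums defining [exp_at] for two values of the bound [r] differ by terms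
that are zero. *)
Lemma exp_at_unique (D : O -> O) p q q' : D 0 = 0 ->
  exp_at D p q -> exp_at D p q' -> q = q'.
Proof.
move=> D0 [r [zr ->]] [r' [zr' ->]].
have iter0 i k : iter i D p = 0 -> (i <= k)%N -> iter k D p = 0.
  by move=> zi /subnK <-; rewrite iterD zi; elim: (k - i)%N => //= j ->.
pose F i := (i`!%:R)^-1 *: iter i D p.
have ext i k : iter i D p = 0 -> (i <= k)%N ->
    \sum_(j < i) F j = \sum_(j < k) F j.
  move=> zi ik.
  rewrite -2!(big_mkord xpredT F) [RHS](big_cat_nat (leq0n i) ik).
  rewrite [X in _ = _ + X]big_nat_cond [X in _ = _ + X]big1 ?addr0 //=.
  move=> j /andP[/andP[ij _] _].
  by rewrite /F (iter0 i j) ?scaler0.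
by rewrite [LHS](ext _ _ zr (leq_maxl r r')) [RHS](ext _ _ zr' (leq_maxr r r')).
Qed.

Variable N : {linear X -> X}.
Hypothesis NN0 : forall A, N (N A) = 0.
Let M := lin_mx N.

Lemma lin_mx_square_zero : M *m M = 0.
Proof.
apply/row_matrixP => i; rewrite row0 rowE mulmxA.
by rewrite -[delta_mx 0 i]vec_mxK !mul_vec_lin /= NN0 raddf0.
Qed.
Let MM0 := lin_mx_square_zero.

Lemma mxeval_flow p u A :
  mxeval (flow M p).[u] A = mxeval p (A + mxeval u A *: N A).
Proof.
rewrite /mxeval flow_eval; apply: meval_eq => i.
by rewrite mul_vec_lin [mxvec (_ + _)]linearD linearZ.
Qed.

Lemma regular_flow u : regular (fun A => A + mxeval u A *: N A).
Proof. by move=> p; exists (flow M p).[u] => A; rewrite mxeval_flow. Qed.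

Lemma mxevalX i (A : X) : mxeval 'X_i A = mxvec A 0 i.
Proof. by rewrite /mxeval mevalXU. Qed.

(** An automorphism is determined by its comorphism, and the comorphism by its
values on the coordinate functions. *)
Lemma exp_subgroup_replicaP f (D : O -> O) (g : autX K n m) :
    vector_field M f = 0 -> (forall p, D p = f * vector_field M p) ->
  exp_subgroup D g <-> exists s, forall A, g A = A + (s * mxeval f A) *: N A.
Proof.
move=> f0 DE.
have expE s p : exp_at (fun u => s *: D u) p (flow M p).[s *: f].
  have [r [zr ->]] := exp_at_replica MM0 charK s p f0.
  have iterE i : iter i (fun u => s *: D u) p =
      iter i (fun u => s *: (f * vector_field M u)) p.
    by apply: eq_iter => u; rewrite DE.
  by exists r; split; [rewrite iterE | apply: eq_bigr => i _; rewrite iterE].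
have evalE s A : mxeval (s *: f) A = s * mxeval f A by rewrite /mxeval mevalZ.
split=> [[s gE]|[s gE]]; exists s.
  move=> A; apply: (can_inj mxvecK); apply/rowP => i.
  have [q [qE gq]] := gE 'X_i.
  rewrite -!mxevalX gq -evalE -mxeval_flow.
  congr (mxeval _ A); apply: exp_at_unique qE (expE _ _).
  by rewrite DE vector_field0 mulr0 scaler0.
move=> p; exists (flow M p).[s *: f]; split=> // A.
by rewrite gE mxeval_flow evalE.
Qed.

(** The flow of [f D] moves each point along a trajectory of [D], on which [f]
is constant; so its inverse is obtained by changing the sign of [f]. *)
Lemma replica_flow_aut f :
    (forall c A, mxeval f (A + c *: N A) = mxeval f A) ->
  exists g : autX K n m, forall A, g A = A + mxeval f A *: N A.
Proof.
move=> f_inv.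
have mxevalN A : mxeval (- f) A = - mxeval f A by rewrite /mxeval mevalN.
have fK : cancel (fun A => A + mxeval f A *: N A)
                 (fun A => A + mxeval (- f) A *: N A).
  move=> A; rewrite mxevalN f_inv linearD linearZ /= NN0 scaler0 addr0.
  by rewrite scaleNr addrK.
have gK : cancel (fun A => A + mxeval (- f) A *: N A)
                 (fun A => A + mxeval f A *: N A).
  move=> A; rewrite f_inv mxevalN linearD linearZ /= NN0 scaler0 addr0.
  by rewrite scaleNr subrK.
by exists (AutX fK gK (regular_flow _) (regular_flow _)).
Qed.

(** A polynomial in an entry that does not move along the flow is a constant
of motion. *)
Lemma invariant_entry_poly (P : {poly K}) a b : (forall A, N A a b = 0) ->
  exists f : O,
    vector_field M f = 0 /\ forall A, mxeval f A = P.[A a b].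
Proof.
move=> Nab; pose c := mxvec_index a b.
have X0 : vector_field M 'X_c = 0.
  rewrite vector_fieldX /field_coord big1 // => j _.
  suff -> : M j c = 0 by rewrite scale0r.
  have -> : M j c = (row j M) 0 c by rewrite [RHS]mxE.
  by rewrite rowE -[delta_mx 0 j]vec_mxK mul_vec_lin mxvecE Nab.
elim/poly_ind: P => [|P x [f [f0 fE]]].
  by exists 0; split=> [|A]; rewrite ?vector_field0 // /mxeval meval0 horner0.
exists (f * 'X_c + x%:MP); split=> [|A].
  by rewrite vector_fieldD vector_fieldM f0 X0 vector_fieldC mul0r mulr0 !addr0.
rewrite /mxeval mevalD mevalM mevalC hornerMXaddC -fE.
by congr (_ * _ + _); rewrite mevalXU mxvecE.
Qed.

(** The hypothesis on [H] says that [H] is the one-parameter group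
[A |-> A + s *: N A]. *)
Lemma elementary_shear (H : autX K n m -> Prop) (P : {poly K}) a b :
    root_subgroup H ->
    (forall g, H g <-> exists s, forall A, g A = A + s *: N A) ->
    (forall A, N A a b = 0) ->
  exists2 g : autX K n m,
    elementary_group g & forall A, g A = A + P.[A a b] *: N A.
Proof.
move=> rootH HE Nab; have [f [f0 fE]] := invariant_entry_poly P Nab.
have [c A|g gE] := @replica_flow_aut f.
  by rewrite !fE !mxE Nab mulr0 addr0.
exists g; last by move=> A; rewrite gE fE.
apply: generated_in; exists (exp_subgroup (fun p => f * vector_field M p)).
  right; exists H => //; exists (vector_field M), f; split=> //.
  - by split; [exact: vector_field_is_linear | exact: vector_fieldM].
  - exact: vector_field_nilpotent MM0.
  move=> h; rewrite HE (@exp_subgroup_replicaP 1).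
  - have eval1 (A : X) : mxeval 1 A = 1 by rewrite /mxeval meval1.
    by split=> -[s hE]; exists s => A; rewrite hE eval1 mulr1.
  - by rewrite -mpolyC1 vector_fieldC.
  - by move=> p; rewrite mul1r.
by apply/(exp_subgroup_replicaP _ f0) => //; exists 1 => A; rewrite mul1r gE.
Qed.

End ExpSubgroup.

(** * Row and column operations *)

Section LineOperations.
Variable K : fieldType.

Definition row_op n m (k l : 'I_n) (c : K) (A : 'M[K]_(n, m)) :=
  A + c *: (delta_mx k l *m A).

Definition col_op n m (k l : 'I_m) (c : K) (A : 'M[K]_(n, m)) :=
  (row_op k l c A^T)^T.

Lemma row_opE n m k l c (A : 'M[K]_(n, m)) i j :
  row_op k l c A i j = A i j + (i == k)%:R * c * A l j.
Proof.
rewrite !mxE (bigD1 l) //= !mxE eqxx andbT big1 ?addr0 => [|h hl].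
  by rewrite mulrCA mulrA.
by rewrite mxE (negPf hl) andbF mul0r.
Qed.

Lemma col_opE n m k l c (A : 'M[K]_(n, m)) i j :
  col_op k l c A i j = A i j + (j == k)%:R * c * A i l.
Proof. by rewrite mxE row_opE !mxE. Qed.

Lemma tr_row_op n m k l c (A : 'M[K]_(n, m)) :
  (row_op k l c A)^T = col_op k l c A^T.
Proof. by rewrite /col_op trmxK. Qed.

Lemma tr_col_op n m k l c (A : 'M[K]_(n, m)) :
  (col_op k l c A)^T = row_op k l c A^T.
Proof. exact: trmxK. Qed.

Lemma row_op0 n m k l (A : 'M[K]_(n, m)) : row_op k l 0 A = A.
Proof. by rewrite /row_op scale0r addr0. Qed.

Lemma col_op0 n m k l (A : 'M[K]_(n, m)) : col_op k l 0 A = A.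
Proof. by rewrite /col_op row_op0 trmxK. Qed.

Lemma row_opK n m k l c (A : 'M[K]_(n, m)) : k != l ->
  row_op k l (- c) (row_op k l c A) = A.
Proof.
move=> kl; apply/matrixP => i j; rewrite !row_opE eq_sym (eq_sym l) (negPf kl).
by rewrite !mul0r addr0 mulrN mulNr addrK.
Qed.

Lemma col_opK n m k l c (A : 'M[K]_(n, m)) : k != l ->
  col_op k l (- c) (col_op k l c A) = A.
Proof. by move=> kl; rewrite /col_op trmxK row_opK // trmxK. Qed.

(** * Rank and determinant *)

Definition same_rank_det n m (A A' : 'M[K]_(n, m)) : Prop :=
  \rank A = \rank A' /\
  forall e : m = n,
    \det (castmx (erefl n, e) A) = \det (castmx (erefl n, e) A').

Lemma same_rank_det_refl n m (A : 'M[K]_(n, m)) : same_rank_det A A.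
Proof. by []. Qed.

Lemma same_rank_det_sym n m (A A' : 'M[K]_(n, m)) :
  same_rank_det A A' -> same_rank_det A' A.
Proof. by case=> rA dA; split=> // e; rewrite dA. Qed.

Lemma same_rank_det_trans n m (A1 A2 A3 : 'M[K]_(n, m)) :
  same_rank_det A1 A2 -> same_rank_det A2 A3 -> same_rank_det A1 A3.
Proof.
by case=> r12 d12 [r23 d23]; split=> [|e]; rewrite ?r12 // d12 d23.
Qed.

Lemma same_rank_det_tr n m (A A' : 'M[K]_(n, m)) :
  same_rank_det A A' -> same_rank_det A^T A'^T.
Proof.
case=> rA dA; split=> [|e]; first by rewrite !mxrank_tr.
by have := dA (esym e); subst; rewrite !castmx_id !det_tr.
Qed.

Lemma det_transvection n (k l : 'I_n) (c : K) : k != l ->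
  \det (1%:M + c *: delta_mx k l) = 1.
Proof.
wlog lk : k l / (l < k)%N => [gen kl|kl].
  have [/gen|kl'|/val_inj lk] := ltngtP l k; first exact.
    rewrite -det_tr linearD linearZ /= tr_scalar_mx trmx_delta.
    by apply: gen; rewrite // eq_sym.
  by rewrite lk eqxx in kl.
rewrite det_trig.
  apply: big1 => i _; rewrite !mxE eqxx; case: eqP => [->|_] /=.
    by rewrite (negPf kl) mulr0 addr0.
  by rewrite mulr0 addr0.
apply/is_trig_mxP => i j ij; rewrite !mxE -val_eqE (ltn_eqF ij).
case: (i =P k) => [ik|_]; case: (j =P l) => [jl|_] /=; rewrite ?mulr0 ?addr0 //.
by move: ij; rewrite ik jl ltnNge (ltnW lk).
Qed.

Lemma same_rank_det_row_op n m k l c (A : 'M[K]_(n, m)) : k != l ->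
  same_rank_det A (row_op k l c A).
Proof.
move=> kl; have detU := det_transvection c kl.
have -> : row_op k l c A = (1%:M + c *: delta_mx k l) *m A.
  by rewrite mulmxDl mul1mx -scalemxAl.
split=> [|e].
  by rewrite eqmxMfull // row_full_unit unitmxE detU unitr1.
by subst; rewrite !castmx_id det_mulmx detU mul1r.
Qed.

Lemma same_rank_det_col_op n m k l c (A : 'M[K]_(n, m)) : k != l ->
  same_rank_det A (col_op k l c A).
Proof.
move=> kl; rewrite -{1}[A]trmxK; apply: same_rank_det_tr.
exact: same_rank_det_row_op.
Qed.

Lemma same_rank_det_eq0 n m (A A' : 'M[K]_(n, m)) :
  same_rank_det A A' -> (A == 0) = (A' == 0).
Proof. by case=> rA _; rewrite -!mxrank_eq0 rA. Qed.

Lemma same_rank_det_block n m (a : K) (A A' : 'M[K]_(n, m)) : a != 0 ->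
  same_rank_det (block_mx (a%:M : 'M_1) 0 0 A) (block_mx (a%:M : 'M_1) 0 0 A') ->
  same_rank_det A A'.
Proof.
move=> a0 [rA dA]; split=> [|e].
  by move: rA; rewrite !rank_diag_block_mx => /addnI.
move: (dA (congr1 (addn 1) e)); subst; rewrite !castmx_id !det_ublock.
by rewrite det_scalar1; apply: mulfI.
Qed.

(** * Classification modulo transvections *)

(** [R] and [C] select the rows and columns that may be modified; the line whose
multiple is added is arbitrary. *)
Inductive line_op n m (R : pred 'I_n) (C : pred 'I_m)
    (A A' : 'M[K]_(n, m)) : Prop :=
| RowOp k l c of k != l & R k & A' = row_op k l c A
| ColOp k l c of k != l & C k & A' = col_op k l c A.

Inductive line_eq n m (R : pred 'I_n) (C : pred 'I_m) :
    'M[K]_(n, m) -> 'M[K]_(n, m) -> Prop :=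
| line_eq_refl A : line_eq R C A A
| line_eq_step A A1 A' : line_op R C A A1 -> line_eq R C A1 A' ->
    line_eq R C A A'.

Lemma line_eq_op n m (R : pred 'I_n) (C : pred 'I_m) A A' :
  line_op R C A A' -> line_eq R C A A'.
Proof. by move/line_eq_step; apply; apply: line_eq_refl. Qed.

Lemma line_eq_trans n m (R : pred 'I_n) (C : pred 'I_m) A1 A2 A3 :
  line_eq R C A1 A2 -> line_eq R C A2 A3 -> line_eq R C A1 A3.
Proof. by elim=> // A A' A'' op _ IH /IH; apply: line_eq_step. Qed.

Lemma line_eq_sym n m (R : pred 'I_n) (C : pred 'I_m) A A' :
  line_eq R C A A' -> line_eq R C A' A.
Proof.
elim=> {A A'} [A|A A1 A' op _]; first exact: line_eq_refl.
move/line_eq_trans; apply; apply: line_eq_op.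
case: op => k l c kl ok ->.
- by apply: (@RowOp _ _ _ _ _ _ k l (- c)); rewrite ?row_opK.
- by apply: (@ColOp _ _ _ _ _ _ k l (- c)); rewrite ?col_opK.
Qed.

Lemma line_eq_tr n m (R : pred 'I_n) (C : pred 'I_m) A A' :
  line_eq R C A A' -> line_eq C R A^T A'^T.
Proof.
elim=> {A A'} [A|A A1 A' op _]; first exact: line_eq_refl.
apply: line_eq_step; case: op => k l c kl ok ->.
- by apply: (@ColOp _ _ _ _ _ _ k l c); rewrite // tr_row_op.
- by apply: (@RowOp _ _ _ _ _ _ k l c); rewrite // tr_col_op.
Qed.

Lemma line_eq_predT n m (R : pred 'I_n) (C : pred 'I_m) A A' :
  line_eq R C A A' -> line_eq predT predT A A'.
Proof.
elim=> {A A'} [A|A A1 A' op _]; first exact: line_eq_refl.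
by apply: line_eq_step; case: op => k l c kl _ ->;
  [exact: RowOp kl isT erefl | exact: ColOp kl isT erefl].
Qed.

Lemma line_eq_same_rank_det n m (R : pred 'I_n) (C : pred 'I_m) A A' :
  line_eq R C A A' -> same_rank_det A A'.
Proof.
elim=> {A A'} [A|A A1 A' op _]; first exact: same_rank_det_refl.
apply: same_rank_det_trans; case: op => k l c kl _ ->.
  exact: same_rank_det_row_op.
exact: same_rank_det_col_op.
Qed.

Lemma row_op_block n m (a : 'M_1) k l c (A : 'M[K]_(n, m)) :
  row_op (rshift 1 k) (rshift 1 l) c (block_mx a 0 0 A) =
  block_mx a 0 0 (row_op k l c A).
Proof.
rewrite /row_op.
have -> : delta_mx (rshift 1 k) (rshift 1 l) =
    block_mx 0 0 0 (delta_mx k l) :> 'M[K]_(1 + n).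
  by rewrite delta_mx_dshift delta_mx_rshift /block_mx row_mx0.
rewrite mulmx_block scale_block_mx add_block_mx !mul0mx !mulmx0 !addr0.
by rewrite !scaler0 !add0r !addr0.
Qed.

Lemma col_op_block n m (a : 'M_1) k l c (A : 'M[K]_(n, m)) :
  col_op (rshift 1 k) (rshift 1 l) c (block_mx a 0 0 A) =
  block_mx a 0 0 (col_op k l c A).
Proof.
by rewrite /col_op tr_block_mx !trmx0 row_op_block tr_block_mx !trmx0 trmxK.
Qed.

Lemma line_eq_block n m (a : 'M_1) (A A' : 'M[K]_(n, m)) :
  line_eq predT predT A A' ->
  line_eq (predC1 ord0) (predC1 ord0) (block_mx a 0 0 A) (block_mx a 0 0 A').
Proof.
elim=> {A A'} [A|A A1 A' op _]; first exact: line_eq_refl.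
apply: line_eq_step; case: op => k l c kl _ ->.
- apply: (@RowOp _ _ _ _ _ _ (rshift 1 k) (rshift 1 l) c) => //.
  exact/esym/row_op_block.
- apply: (@ColOp _ _ _ _ _ _ (rshift 1 k) (rshift 1 l) c) => //.
  exact/esym/col_op_block.
Qed.

Lemma clear_col n m (A : 'M[K]_(n.+1, m.+1)) (C : pred 'I_m.+1) : A 0 0 != 0 ->
  exists2 A', line_eq (predC1 ord0) C A A' &
    (forall j, A' 0 j = A 0 j) /\ (forall k : 'I_n.+1, k != 0 -> A' k 0 = 0).
Proof.
move=> A00.
suff [A' AA' [row0 col0]]: exists2 A', line_eq (predC1 ord0) C A A' &
    (forall j, A' 0 j = A 0 j) /\
    (forall k : 'I_n.+1, k \in enum 'I_n.+1 -> k != 0 -> A' k 0 = 0).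
  by exists A' => //; split=> // k; apply: col0; rewrite mem_enum.
elim: (enum _) => [|k s [A' AA' [row0 col0]]].
  by exists A; [exact: line_eq_refl | split].
have [->|k0] := eqVneq k 0.
  exists A' => //; split=> // h; rewrite inE => /orP[/eqP-> /eqP//|]; exact: col0.
exists (row_op k 0 (- A' k 0 / A 0 0) A').
  apply: line_eq_trans AA' (line_eq_op _).
  by apply: (@RowOp _ _ _ _ _ _ k 0 (- A' k 0 / A 0 0)).
split=> [j|h].
  by rewrite row_opE eq_sym (negPf k0) !mul0r addr0.
rewrite row_opE inE row0; case: eqP => [-> _ _|_ /= hs h0].
  by rewrite mul1r divfK // subrr.
by rewrite !mul0r addr0 col0.
Qed.

(** Subtracting multiples of the first row clears the first column; then
subtracting multiples of the first column clears the first row and leaves the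
clean first column as it is. *)
Lemma clear_cross n m (A : 'M[K]_(1 + n, 1 + m)) : A 0 0 != 0 ->
  exists A1, line_eq (predC1 ord0) (predC1 ord0) A
               (block_mx ((A 0 0)%:M : 'M_1) 0 0 A1).
Proof.
move=> A00.
have [A' AA' [row0 col0]] := @clear_col n m A (predC1 ord0) A00.
have [|D A'D [Drow Dcol]] := @clear_col m n A'^T (predC1 ord0).
  by rewrite mxE row0.
have {A'D} AD : line_eq (predC1 ord0) (predC1 ord0) A D^T.
  by apply: line_eq_trans AA' _; rewrite -[A']trmxK; apply: line_eq_tr.
pose E : 'M[K]_(1 + n, 1 + m) := D^T; exists (drsubmx E).
suff -> : block_mx (A 0 0)%:M 0 0 (drsubmx E) = E by [].
have lshift0 p : @lshift 1 p 0 = 0 :> 'I_p.+1 by apply: val_inj.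
rewrite -[RHS]submxK; congr block_mx; apply/matrixP => i j; rewrite !mxE !ord1.
- by rewrite !lshift0 Drow mxE row0.
- by rewrite lshift0 Dcol.
- by rewrite lshift0 Drow mxE col0.
Qed.

(** Equality of the ranks and determinants passes to the complementary blocks,
because the common corner entry is nonzero. *)
Lemma line_eq_same_corner n m
    (IH : forall A A' : 'M[K]_(n, m), same_rank_det A A' ->
       line_eq predT predT A A')
    (A A' : 'M[K]_(1 + n, 1 + m)) :
  A 0 0 != 0 -> A 0 0 = A' 0 0 -> same_rank_det A A' ->
  line_eq (predC1 ord0) (predC1 ord0) A A'.
Proof.
move=> A0 AA' cl; have [A1 eA] := clear_cross A0.
have [|A1' eA'] := @clear_cross _ _ A'; first by rewrite -AA'.
rewrite -AA' in eA'.
apply: (line_eq_trans eA); apply: line_eq_trans (line_eq_sym eA').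
apply/line_eq_block/IH/(same_rank_det_block A0).
apply: same_rank_det_trans (line_eq_same_rank_det eA').
exact/(same_rank_det_trans _ cl)/same_rank_det_sym/(line_eq_same_rank_det eA).
Qed.

(** A nonzero entry is brought to the first row, then to a position of that row
other than the corner; from there a multiple of its column makes the corner
equal to one. *)
Lemma line_eq_corner1_wide n m (A : 'M[K]_(n.+1, m.+2)) : A != 0 ->
  exists2 A', line_eq predT predT A A' & A' 0 0 = 1.
Proof.
move=> /matrix0Pn[k [l Akl]].
have [A1 AA1 {k l Akl} [l A1l]]: exists2 A1, line_eq predT predT A A1 &
    exists l, A1 0 l != 0.
  have [A0l|A0l] := eqVneq (A 0 l) 0; last first.
    by exists A; [exact: line_eq_refl | exists l].
  have k0 : 0 != k by apply: contraNneq Akl => <-; rewrite A0l.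
  exists (row_op 0 k 1 A); first by apply: line_eq_op; exact: RowOp k0 isT erefl.
  by exists l; rewrite row_opE A0l add0r !mul1r.
have [A2 AA2 {A1 AA1 l A1l} [l l0 A2l]]: exists2 A2, line_eq predT predT A A2 &
    exists2 l, l != 0 & A2 0 l != 0.
  have [l0|l0] := eqVneq l 0; last by exists A1 => //; exists l.
  have [A11|A11] := eqVneq (A1 0 1) 0; last by exists A1 => //; exists 1.
  exists (col_op 1 0 1 A1).
    apply: line_eq_trans AA1 (line_eq_op _).
    by apply: (@ColOp _ _ _ _ _ _ 1 0 1) => //.
  by exists 1; rewrite // col_opE A11 add0r !mul1r -l0.
exists (col_op 0 l ((1 - A2 0 0) / A2 0 l) A2); last first.
  by rewrite col_opE mul1r divfK // addrC subrK.
apply: line_eq_trans AA2 (line_eq_op _).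
by apply: (@ColOp _ _ _ _ _ _ 0 l _ _ _ erefl); rewrite // eq_sym.
Qed.

Lemma line_eq_corner1 n m (A : 'M[K]_(n.+1, m.+1)) : (0 < n + m)%N -> A != 0 ->
  exists2 A', line_eq predT predT A A' & A' 0 0 = 1.
Proof.
case: m A => [|m] A; last by move=> _; apply: line_eq_corner1_wide.
case: n A => [//|n] A _ A0.
have [|A' AA' A'1] := @line_eq_corner1_wide 0 n A^T.
  by rewrite -trmx0 (inj_eq trmx_inj).
exists A'^T; last by rewrite mxE.
by rewrite -[A]trmxK; apply: line_eq_tr.
Qed.

(** By induction on the size: once both corners are equal to one, only the
complementary blocks have to be compared.  The corner can be normalized except
in size one, where the determinant is the matrix itself. *)
Lemma same_rank_det_line_eq n m (A A' : 'M[K]_(n, m)) :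
  same_rank_det A A' -> line_eq predT predT A A'.
Proof.
elim: n m A A' => [|n IHn] m A A' cl.
  by rewrite [A]flatmx0 [A']flatmx0; apply: line_eq_refl.
case: m A A' cl => [|m] A A' cl.
  by rewrite [A]thinmx0 [A']thinmx0; apply: line_eq_refl.
have [A0|A0] := eqVneq A 0.
  have := same_rank_det_eq0 cl; rewrite A0 eqxx => /esym/eqP ->.
  exact: line_eq_refl.
have [nm0|nm] := posnP (n + m)%N.
  move/eqP: nm0; rewrite addn_eq0 => /andP[/eqP n0 /eqP m0].
  case: cl => _ /(_ _)/=; subst => /(_ erefl).
  rewrite !castmx_id [A]mx11_scalar [A']mx11_scalar !det_scalar1 => ->.
  exact: line_eq_refl.
have [A1 AA1 A1c] := line_eq_corner1 nm A0.
have [|A1' AA1' A1c'] := @line_eq_corner1 _ _ A' nm.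
  by rewrite -(same_rank_det_eq0 cl).
apply: (line_eq_trans AA1); apply: line_eq_trans (line_eq_sym AA1').
apply: line_eq_predT (line_eq_same_corner (IHn m) _ _ _).
- by rewrite A1c oner_eq0.
- by rewrite A1c A1c'.
apply: same_rank_det_trans (line_eq_same_rank_det AA1').
exact/(same_rank_det_trans _ cl)/same_rank_det_sym/(line_eq_same_rank_det AA1).
Qed.

End LineOperations.

(** * Moving several matrices at once *)

Section Configurations.
Variable K : fieldType.

Lemma interpolation r (x c : 'I_r -> K) : injective x ->
  exists P : {poly K}, forall i, P.[x i] = c i.
Proof.
move=> x_inj.
pose L i := \prod_(j | j != i) ((x i - x j)^-1 *: ('X - (x j)%:P)).
exists (\sum_i c i *: L i) => i; rewrite horner_sum (bigD1 i) //= big1 => [|j ji].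
  rewrite addr0 hornerZ horner_prod big1 ?mulr1 // => j ji.
  rewrite hornerZ hornerXsubC mulVf // subr_eq0.
  by apply: contra ji => /eqP/x_inj ->.
rewrite hornerZ horner_prod (bigD1 i) 1?eq_sym //=.
by rewrite hornerZ hornerXsubC subrr mulr0 mul0r mulr0.
Qed.

(** The condition [a != k] (resp. [b != k]) makes the coefficient an invariant
of the operation; this is why the map lies in a replica of a root subgroup. *)
Inductive shear n m (S : 'M[K]_(n, m) -> 'M[K]_(n, m)) : Prop :=
| RowShear k l a b P of k != l & a != k &
    (forall A, S A = row_op k l P.[A a b] A)
| ColShear k l a b P of k != l & b != k &
    (forall A, S A = col_op k l P.[A a b] A).

Inductive shear_word n m : ('M[K]_(n, m) -> 'M[K]_(n, m)) -> Prop :=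
| shear_id : shear_word id
| shear_comp S phi : shear S -> shear_word phi -> shear_word (phi \o S).

Definition reach n m r (B B' : 'I_r -> 'M[K]_(n, m)) : Prop :=
  exists2 phi, shear_word phi & forall i, phi (B i) = B' i.

Lemma shear_word_comp n m (phi psi : 'M[K]_(n, m) -> 'M[K]_(n, m)) :
  shear_word phi -> shear_word psi -> shear_word (psi \o phi).
Proof.
by elim=> // S {}phi shS _ IH /IH; apply: (@shear_comp _ _ S (psi \o phi)).
Qed.

Lemma shear_same_rank_det n m S (A : 'M[K]_(n, m)) :
  shear S -> same_rank_det A (S A).
Proof.
case=> k l a b P kl _ ->; first exact: same_rank_det_row_op.
exact: same_rank_det_col_op.
Qed.

Lemma shear_word_tr n m (phi : 'M[K]_(n, m) -> 'M[K]_(n, m)) :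
  shear_word phi ->
  exists2 psi, shear_word psi & forall A, psi A^T = (phi A)^T.
Proof.
elim=> [|S {}phi shS _ [psi wpsi psiE]]; first by exists id => //; apply: shear_id.
exists (psi \o (fun A => (S A^T)^T)); last by move=> A; rewrite /= trmxK psiE.
apply: shear_comp wpsi; case: shS => k l a b P kl ak SE.
- apply: (@ColShear _ _ _ k l b a P) => // A.
  by rewrite SE tr_row_op trmxK mxE.
- apply: (@RowShear _ _ _ k l b a P) => // A.
  by rewrite SE tr_col_op trmxK mxE.
Qed.

Section Reach.
Variable r : nat.

Lemma reach_refl n m (B : 'I_r -> 'M[K]_(n, m)) : reach B B.
Proof. by exists id => //; apply: shear_id. Qed.

Lemma reach_trans n m (B1 B2 B3 : 'I_r -> 'M[K]_(n, m)) :
  reach B1 B2 -> reach B2 B3 -> reach B1 B3.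
Proof.
case=> phi wphi phiE [psi wpsi psiE]; exists (psi \o phi).
  exact: shear_word_comp.
by move=> i; rewrite /= phiE psiE.
Qed.

Lemma reach_eq n m (B B1 B2 : 'I_r -> 'M[K]_(n, m)) :
  B1 =1 B2 -> reach B B1 -> reach B B2.
Proof. by move=> B12 [phi wphi phiE]; exists phi => // i; rewrite phiE B12. Qed.

Lemma reach_tr n m (B B' : 'I_r -> 'M[K]_(n, m)) :
  reach B B' -> reach (fun i => (B i)^T) (fun i => (B' i)^T).
Proof.
case=> phi /shear_word_tr[psi wpsi psiE] phiE.
by exists psi => // i; rewrite psiE phiE.
Qed.

Lemma reach_same_rank_det n m (B B' : 'I_r -> 'M[K]_(n, m)) :
  reach B B' -> forall i, same_rank_det (B i) (B' i).
Proof.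
case=> phi wphi phiE i; rewrite -phiE.
elim: wphi (B i) => [|S psi shS _ IH] A /=; first exact: same_rank_det_refl.
exact: same_rank_det_trans (shear_same_rank_det _ shS) (IH _).
Qed.

(** Distinct entries in position [(a, b)] let the coefficient be chosen freely
for each matrix of the family. *)
Lemma reach_row_op n m (k l : 'I_n) (c : 'I_r -> K) (a : 'I_n) b
    (B : 'I_r -> 'M[K]_(n, m)) :
    k != l -> a != k -> injective (fun i => B i a b) ->
  reach B (fun i => row_op k l (c i) (B i)).
Proof.
move=> kl ak /interpolation-/(_ c)[P PE].
exists (id \o fun A : 'M_(n, m) => row_op k l P.[A a b] A); last first.
  by move=> i /=; rewrite PE.
by apply: shear_comp; [apply: (@RowShear _ _ _ k l a b P) | apply: shear_id].
Qed.

Lemma reach_row_op_const n m (k l : 'I_n) c (B : 'I_r -> 'M[K]_(n, m.+1)) :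
  k != l -> reach B (fun i => row_op k l c (B i)).
Proof.
move=> kl; exists (id \o row_op k l c) => //.
apply: shear_comp; last exact: shear_id.
(* The coefficient polynomial is constant, so any entry off row [k] will do. *)
apply: (@RowShear _ _ _ k l l 0 c%:P) => // [|A]; first by rewrite eq_sym.
by rewrite hornerC.
Qed.

Lemma reach_col_op n m (k l : 'I_m) (c : 'I_r -> K) a (b : 'I_m)
    (B : 'I_r -> 'M[K]_(n, m)) :
    k != l -> b != k -> injective (fun i => B i a b) ->
  reach B (fun i => col_op k l (c i) (B i)).
Proof.
move=> kl bk Binj.
have /(reach_row_op c kl bk)/reach_tr : injective (fun i => (B i)^T b a).
  by move=> i j; rewrite !mxE; apply: Binj.
by case=> phi wphi phiE; exists phi => // i; rewrite -[B i]trmxK phiE trmxK.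
Qed.

(** * Independent motions once the corner entries are distinct *)

Lemma reach_line_op1 n m (B : 'I_r -> 'M[K]_(n.+1, m.+1)) i0 A' :
  injective (fun i => B i 0 0) ->
  line_op (predC1 ord0) (predC1 ord0) (B i0) A' ->
  reach B (fun i => if i == i0 then A' else B i).
Proof.
move=> Binj op; pose delta i (c : K) : K := if i == i0 then c else 0.
case: op => k l c kl k0 ->.
- apply: (reach_eq _ (reach_row_op (delta^~ c) kl _ Binj)) => [i|].
    by rewrite /delta; case: eqP => [->|_] //; rewrite row_op0.
  by rewrite eq_sym.
- apply: (reach_eq _ (reach_col_op (delta^~ c) kl _ Binj)) => [i|].
    by rewrite /delta; case: eqP => [->|_] //; rewrite col_op0.
  by rewrite eq_sym.
Qed.

Lemma line_op_corner n m (A A' : 'M[K]_(n.+1, m.+1)) :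
  line_op (predC1 ord0) (predC1 ord0) A A' -> A' 0 0 = A 0 0.
Proof.
case=> k l c _ k0 ->; rewrite ?row_opE ?col_opE eq_sym (negPf k0).
  by rewrite !mul0r addr0.
by rewrite !mul0r addr0.
Qed.

Lemma line_eq_corner n m (A A' : 'M[K]_(n.+1, m.+1)) :
  line_eq (predC1 ord0) (predC1 ord0) A A' -> A' 0 0 = A 0 0.
Proof. by elim=> // {A A'} A A1 A' /line_op_corner <-. Qed.

Lemma reach_line_eq1 n m (B : 'I_r -> 'M[K]_(n.+1, m.+1)) i0 A' :
  injective (fun i => B i 0 0) ->
  line_eq (predC1 ord0) (predC1 ord0) (B i0) A' ->
  reach B (fun i => if i == i0 then A' else B i).
Proof.
move=> Binj; have [A BA] : exists A, B i0 = A by exists (B i0).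
rewrite BA => BA'; elim: BA' B Binj BA => {A A'} [A|A A1 A' op _ IH] B Binj BA.
  by apply: reach_eq (reach_refl B) => i; case: eqP => [->|].
rewrite -BA in op; apply: (reach_trans (reach_line_op1 Binj op)).
apply: reach_eq (IH _ _ _) => [i||] /=.
- by case: eqP.
- have cornerE i : (if i == i0 then A1 else B i) 0 0 = B i 0 0.
    by case: eqP => // ->; apply: line_op_corner op.
  by move=> i j; rewrite !cornerE; apply: Binj.
- by rewrite eqxx.
Qed.

(** The matrices are moved one after the other; the corner entries, which serve
to tell them apart, are preserved all along. *)
Lemma reach_line_eq n m (B B' : 'I_r -> 'M[K]_(n.+1, m.+1)) :
  injective (fun i => B i 0 0) ->
  (forall i, line_eq (predC1 ord0) (predC1 ord0) (B i) (B' i)) ->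
  reach B B'.
Proof.
move=> Binj BB'.
suff: reach B (fun i => if i \in enum 'I_r then B' i else B i).
  by apply: reach_eq => i; rewrite mem_enum.
elim: (enum _) => [|i0 s IH]; first exact: reach_refl.
apply: (reach_trans IH); set C := fun i : 'I_r => _.
have Cinj : injective (fun i => C i 0 0).
  have CE i : C i 0 0 = B i 0 0.
    by rewrite /C; case: ifP => // _; apply: line_eq_corner.
  by move=> i j; rewrite !CE; apply: Binj.
apply: reach_eq (reach_line_eq1 (i0 := i0) (A' := B' i0) Cinj _) => [i|].
  by rewrite inE; case: eqP => [->|].
by rewrite /C; case: ifP => // _; apply: line_eq_refl.
Qed.

(** * Prescribing the corner entries *)

(** The entry in position [(0, 1)] is first given the prescribed values, with
coefficients depending on the corner; as these values are distinct, the corner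
is then given them, with coefficients depending on the entry [(0, 1)].  A zero
matrix cannot move, whence the last hypothesis. *)
Lemma reach_corner_wide n m (a : 'I_r -> K) (B : 'I_r -> 'M[K]_(n.+1, m.+2)) :
    injective a -> injective (fun i => B i 0 0) ->
    (forall i, B i != 0 -> B i 0 0 != 0) ->
    (forall i, (a i == 0) = (B i == 0)) ->
  exists2 B', reach B B' & forall i, B' i 0 0 = a i.
Proof.
move=> a_inj Binj B0 a0.
pose c i := (a i - B i 0 1) / B i 0 0.
pose C i := col_op 1 0 (c i) (B i).
have BC : reach B C by apply: reach_col_op Binj.
have C01 i : C i 0 1 = a i.
  rewrite col_opE mul1r; have [/eqP|/B0 Bi0] := boolP (B i == 0).
    move=> Bi0; have := a0 i; rewrite Bi0 eqxx => /eqP->.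
    by rewrite !mxE mulr0 addr0.
  by rewrite divfK // addrC subrK.
have C00 i : C i 0 0 = B i 0 0 by rewrite col_opE !mul0r addr0.
pose d i := (a i - B i 0 0) / a i.
exists (fun i => col_op 0 1 (d i) (C i)).
  apply: (reach_trans BC); apply: (@reach_col_op _ _ _ _ _ 0 1) => //.
  by move=> i j; rewrite !C01; apply: a_inj.
move=> i; rewrite col_opE mul1r C01 C00 /d.
have [ai0|ai0] := eqVneq (a i) 0; last by rewrite divfK // addrC subrK.
have := a0 i; rewrite ai0 eqxx => /esym/eqP ->.
by rewrite mulr0 addr0 mxE.
Qed.

Lemma reach_corner n m (a : 'I_r -> K) (B : 'I_r -> 'M[K]_(n.+1, m.+1)) :
    (0 < n + m)%N -> injective a -> injective (fun i => B i 0 0) ->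
    (forall i, B i != 0 -> B i 0 0 != 0) ->
    (forall i, (a i == 0) = (B i == 0)) ->
  exists2 B', reach B B' & forall i, B' i 0 0 = a i.
Proof.
case: m B => [|m] B; last by move=> _; apply: reach_corner_wide.
case: n B => [//|n] B _ a_inj Binj B0 a0.
have trB0 i : ((B i)^T == 0) = (B i == 0) by rewrite -trmx0 (inj_eq trmx_inj).
have [i j|i|i|B' BB' B'E] := @reach_corner_wide 0 n a (fun i => (B i)^T) a_inj.
- by rewrite !mxE; apply: Binj.
- by rewrite trB0 mxE; apply: B0.
- by rewrite trB0.
exists (fun i => (B' i)^T); last by move=> i; rewrite mxE.
have [phi wphi phiE] := reach_tr BB'.
by exists phi => // i; rewrite -phiE trmxK.
Qed.

(** * Making the corner entries distinct *)

Lemma reach_combine_rows n m (u : 'I_n.+1 -> K)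
    (B : 'I_r -> 'M[K]_(n.+1, m.+1)) : u 0 = 1 ->
  exists2 B', reach B B' & forall i j, B' i 0 j = \sum_l u l * B i l j.
Proof.
move=> u0.
suff [B' BB' [B'0 _]]: exists2 B', reach B B' &
    (forall i j, B' i 0 j = B i 0 j +
       \sum_(l <- enum 'I_n.+1 | l != 0) u l * B i l j) /\
    (forall i l j, l != 0 -> B' i l j = B i l j).
  exists B' => // i j.
  by rewrite B'0 [RHS](bigD1 0) //= u0 mul1r big_enum_cond.
elim: (enum _) => [|l s [C BC [C0 Cl]]].
  by exists B; [exact: reach_refl | split=> // i j; rewrite big_nil addr0].
have [l0|l0] := eqVneq l 0.
  by exists C => //; split=> // i j; rewrite big_cons l0 eqxx.
exists (fun i => row_op 0 l (u l) (C i)).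
  by apply: reach_trans BC (reach_row_op_const _ _ _); rewrite eq_sym.
split=> [i j|i k j k0]; rewrite row_opE.
  by rewrite mul1r C0 Cl // big_cons l0 -addrA [_ + u l * _]addrC.
by rewrite (negPf k0) !mul0r addr0 Cl.
Qed.

Lemma reach_combine n m (u : 'I_n.+1 -> K) (v : 'I_m.+1 -> K)
    (B : 'I_r -> 'M[K]_(n.+1, m.+1)) : u 0 = 1 -> v 0 = 1 ->
  exists2 B', reach B B' &
    forall i, B' i 0 0 = \sum_l \sum_j B i l j * (u l * v j).
Proof.
move=> u0 v0; have [C BC CE] := reach_combine_rows B u0.
have [D CD DE] := reach_combine_rows (fun i => (C i)^T) v0.
exists (fun i => (D i)^T) => [|i].
  apply: (reach_trans BC); have [phi wphi phiE] := reach_tr CD.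
  by exists phi => // i; rewrite -phiE trmxK.
rewrite mxE DE exchange_big; apply: eq_bigr => j _.
rewrite mxE CE mulr_sumr; apply: eq_bigr => l _.
by rewrite mulrCA mulrA mulrC mulrA.
Qed.
End Reach.

(** The bilinear form with weights [t ^ l] and [t ^ (n.+1 * j)], as a
polynomial in [t]; all its exponents differ, so it remembers the matrix. *)
Definition corner_poly n m (A : 'M[K]_(n.+1, m.+1)) : {poly K} :=
  \sum_l \sum_j A l j *: 'X^(l + n.+1 * j).

Lemma corner_poly_neq0 n m (A : 'M[K]_(n.+1, m.+1)) :
  A != 0 -> corner_poly A != 0.
Proof.
move=> /matrix0Pn[k [h Akh]].
apply: contraNneq Akh => /(congr1 (fun p : {poly K} => p`_(k + n.+1 * h))).
rewrite coef0 coef_sum (bigD1 k) //= coef_sum (bigD1 h) //=.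
rewrite coefZ coefXn eqxx mulr1.
have expE (l : 'I_n.+1) (j : 'I_m.+1) :
    (k + n.+1 * h == l + n.+1 * j)%N = (l == k) && (j == h).
  apply/eqP/andP=> [E|[/eqP-> /eqP->] //].
  have := congr1 (modn^~ n.+1) E; have := congr1 (divn^~ n.+1) E.
  rewrite !(addnC (nat_of_ord _)) !(mulnC n.+1) !divnMDl // !modnMDl.
  by rewrite !divn_small // !modn_small // !addn0 => /val_inj-> /val_inj->.
rewrite big1 ?addr0 => [|j jh]; last first.
  by rewrite coefZ coefXn expE (negPf jh) andbF mulr0.
rewrite big1 ?addr0 => [-> //|l lk].
rewrite coef_sum big1 // => j _.
by rewrite coefZ coefXn expE (negPf lk) mulr0.
Qed.

Lemma horner_corner_poly n m (A : 'M[K]_(n.+1, m.+1)) t :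
  (corner_poly A).[t] = \sum_l \sum_j A l j * (t ^+ l * t ^+ (n.+1 * j)).
Proof.
rewrite horner_sum; apply: eq_bigr => l _; rewrite horner_sum.
by apply: eq_bigr => j _; rewrite hornerZ hornerXn exprD.
Qed.

Lemma corner_polyB n m (A A' : 'M[K]_(n.+1, m.+1)) :
  corner_poly (A - A') = corner_poly A - corner_poly A'.
Proof.
rewrite -sumrB; apply: eq_bigr => l _; rewrite -sumrB.
by apply: eq_bigr => j _; rewrite !mxE scalerBl.
Qed.

End Configurations.

(** The parameter [t] is chosen off the roots of the polynomials attached to the
nonzero differences and to the nonzero members of the family. *)
Lemma reach_distinct_corners (K : closedFieldType) n m r
    (B : 'I_r -> 'M[K]_(n.+1, m.+1)) : injective B ->
  exists2 B', reach B B' &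
    injective (fun i => B' i 0 0) /\ (forall i, B' i != 0 -> B' i 0 0 != 0).
Proof.
move=> Binj.
pose q := \prod_(ij : 'I_r * 'I_r | ij.1 != ij.2) corner_poly (B ij.1 - B ij.2)
          * \prod_(i | B i != 0) corner_poly (B i).
have q0 : q != 0.
  apply: mulf_neq0; apply/prodf_neq0 => ij ij0; apply: corner_poly_neq0 => //.
  by rewrite subr_eq0 (inj_eq Binj).
have /closed_nonrootP[t] := q0; rewrite rootE hornerM !horner_prod mulf_eq0.
case/norP=> /prodf_neq0 tdiff /prodf_neq0 tnz.
have [||B' BB' B'E] := @reach_combine _ r n m
  (fun l => t ^+ l) (fun j => t ^+ (n.+1 * j)) B; rewrite ?muln0 ?expr0 //.
exists B' => //; split=> [i j|i].
  rewrite !B'E -!horner_corner_poly => /eqP; apply: contraTeq => ij.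
  by have := tdiff (i, j) ij; rewrite corner_polyB hornerD hornerN subr_eq0.
rewrite -(same_rank_det_eq0 (reach_same_rank_det BB' i)) B'E -horner_corner_poly.
exact: tnz.
Qed.

(** * Realization in the elementary group *)

Lemma shear_elementary (K : closedFieldType) (charK : [pchar K] =i pred0) n m
    (S : 'M[K]_(n, m) -> 'M[K]_(n, m)) : shear S ->
  exists2 g : autX K n m, elementary_group g & forall A, g A = S A.
Proof.
case=> k l a b P kl off SE.
- pose N : {linear 'M[K]_(n, m) -> 'M[K]_(n, m)} := mulmx (delta_mx k l).
  have NN0 A : N (N A) = 0.
    by rewrite /= mulmxA mul_delta_mx_0 ?mul0mx // eq_sym.
  have [||A|g Gg gE] := @elementary_shear K charK n m N NN0
      (left_root_subgroup k l) P a b.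
  + by left; exists k, l.
  + move=> g; split=> -[t gE]; exists t => A; rewrite gE /=.
      by rewrite mulmxDl mul1mx -scalemxAl.
    by rewrite mulmxDl mul1mx -scalemxAl.
  + by rewrite mxE big1 // => i _; rewrite mxE (negPf off) mul0r.
  by exists g => // A; rewrite gE SE.
- pose N : {linear 'M[K]_(n, m) -> 'M[K]_(n, m)} := mulmxr (delta_mx l k).
  have NN0 A : N (N A) = 0.
    by rewrite /= -mulmxA mul_delta_mx_0 ?mulmx0.
  have [||A|g Gg gE] := @elementary_shear K charK n m N NN0
      (right_root_subgroup l k) P a b.
  + by right; exists l, k; rewrite eq_sym.
  + move=> g; split=> -[t gE]; exists t => A; rewrite gE /=.
      by rewrite mulmxDr mulmx1 -scalemxAr.
    by rewrite mulmxDr mulmx1 -scalemxAr.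
  + by rewrite mxE big1 // => i _; rewrite mxE (negPf off) andbF mulr0.
  exists g => // A; rewrite gE SE /col_op linearD linearZ /= trmxK.
  by rewrite trmx_mul trmxK trmx_delta.
Qed.

Lemma reach_elementary (K : closedFieldType) (charK : [pchar K] =i pred0) n m r
    (B B' : 'I_r -> 'M[K]_(n, m)) : reach B B' ->
  exists2 g : autX K n m, elementary_group g & forall i, g (B i) = B' i.
Proof.
case=> phi wphi phiE.
have [g Gg gE]: exists2 g : autX K n m, elementary_group g & forall A, g A = phi A.
  elim: wphi => {phi phiE} [|S phi shS _ [h Gh hE]].
    by exists (aut_one K n m); [exact: generated_one|].
  have [g Gg gE] := shear_elementary charK shS.
  exists (aut_mul h g); first exact: generated_mul.
  by move=> A /=; rewrite hE gE.
by exists g => // i; rewrite gE phiE.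
Qed.

Theorem theorem3p3 (K : closedFieldType) (charK : [pchar K] =i pred0)
    (n m : nat) (n_ge1 : (1 <= n)%N) (m_ge1 : (1 <= m)%N)
    (mn_ge2 : (2 <= m * n)%N)
    (r : nat) (B B' : 'I_r -> 'M[K]_(n, m))
    (B_distinct : injective B) (B'_distinct : injective B')
    (eq_rank : forall i, \rank (B i) = \rank (B' i))
    (eq_det : forall (e : m = n) (i : 'I_r),
       \det (castmx (erefl n, e) (B i)) = \det (castmx (erefl n, e) (B' i))) :
  exists2 g : autX K n m, elementary_group g & forall i, g (B i) = B' i.
Proof.
have cl i : same_rank_det (B i) (B' i) by split=> // e; apply: eq_det.
clear eq_rank eq_det.
case: n m n_ge1 m_ge1 mn_ge2 B B' B_distinct B'_distinct cl => [//|n] [//|m] _ _ mn.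
move=> B B' Binj B'inj cl.
have nm0 : (0 < n + m)%N by move: mn; case: (n) (m) => [|?] [|?].
have [C BC [Cinj C0]] := reach_distinct_corners Binj.
have [C' B'C' [C'inj C'0]] := reach_distinct_corners B'inj.
have clC i : same_rank_det (C' i) (C i).
  apply: same_rank_det_trans (reach_same_rank_det BC i).
  apply: same_rank_det_trans (same_rank_det_sym (cl i)).
  exact/same_rank_det_sym/(reach_same_rank_det B'C').
have [|i|D C'D DE] := @reach_corner _ r n m (fun i => C i 0 0) C' nm0 _ C'inj C'0.
- exact: Cinj.
- rewrite (same_rank_det_eq0 (clC i)); apply/idP/idP => [|/eqP->].
    by apply: contraTT; apply: C0.
  by rewrite mxE.
have CD : reach C D.
  apply: reach_line_eq => // i.
  have clCD : same_rank_det (C i) (D i).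
    exact: same_rank_det_trans (same_rank_det_sym (clC i)) (reach_same_rank_det C'D i).
  have [Ci0|Ci0] := eqVneq (C i) 0.
    have := same_rank_det_eq0 clCD; rewrite Ci0 eqxx => /esym/eqP->.
    exact: line_eq_refl.
  apply: line_eq_same_corner clCD; rewrite ?DE ?C0 // => A A'.
  exact: same_rank_det_line_eq.
have [g Gg gE] := reach_elementary charK (reach_trans BC CD).
have [h Gh hE] := reach_elementary charK (reach_trans B'C' C'D).
exists (aut_mul (aut_opp h) g) => [|i].
  by apply: generated_mul => //; apply: generated_inv.
by rewrite /= gE -hE aut_funK.
Qed.
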